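(* Let $n$ be a positive integer. For every $m\in\mathbb{Z}_n=\{0,1,\ldots,n-1\}$ we have $$|\mathbb{Z}_n:\{0,\ldots,m\}|^-=\Big\lceil\frac{n}{2m+1}\Big\rceil,\qquad |\mathbb{Z}_n:\{0,\ldots,m\}|^+=\Big\lfloor\frac{n}{m+1}\Big\rfloor .$$
   Context: $\mathbb{Z}_n=\{0,1,\ldots,n-1\}$ is the group of least nonnegative residues modulo $n$ under addition modulo $n$; sums and differences of elements and subsets are taken in this group, so $A-A=\{a-a' : a,a'\in A\}$, etc. Let $A$ be a non-empty subset of $\mathbb{Z}_n$. A subset $B\subseteq\mathbb{Z}_n$ is called a subfactor of $\mathbb{Z}_n$ relative to $A$ if $(A-A)\cap(B-B)=\{0\}$ and $(A-A)+B=\mathbb{Z}_n$. The lower subindex $|\mathbb{Z}_n:A|^-$ (resp. upper subindex $|\mathbb{Z}_n:A|^+$) is the minimum (resp. maximum) of $|B|$ over all subfactors $B$ of $\mathbb{Z}_n$ relative to $A$. *)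

(* Defs.v *)
From HB Require Import structures.
From mathcomp Require Import all_boot all_order all_algebra.

Set Implicit Arguments.
Unset Strict Implicit.
Unset Printing Implicit Defensive.

Import Order.TTheory GRing.Theory Num.Theory.
Local Open Scope ring_scope.

Definition sumset (G : finZmodType) (A B : {set G}) : {set G} :=
  [set a + b | a in A, b in B].

Definition diffset (G : finZmodType) (A B : {set G}) : {set G} :=
  [set a - b | a in A, b in B].

Definition subfactor (G : finZmodType) (A B : {set G}) : bool :=
  (diffset A A :&: diffset B B == [set 0]) &&
  (sumset (diffset A A) B == [set: G]).

(* The default #|G| bounds every #|B|, so it never affects the minimum over a
   nonempty family; see lower_subindexP and upper_subindexP. *)
Definition lower_subindex (G : finZmodType) (A : {set G}) : nat :=
  \big[minn/#|G|]_(B : {set G} | subfactor A B) #|B|.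

Definition upper_subindex (G : finZmodType) (A : {set G}) : nat :=
  \max_(B : {set G} | subfactor A B) #|B|.

(* {0, ..., m} in Z_n, the group Z_n (n > 0) being 'I_n with n of the form
   k.+1: its canonical zmodType structure is addition modulo n, for n = 1
   included (whereas 'Z_1 is Z/2). *)
Definition initseg (n : nat) (m : 'I_n.+1) : {set 'I_n.+1} :=
  [set i : 'I_n.+1 | (i <= m)%N].

Lemma subfactor_exists (G : finZmodType) (A : {set G}) :
  A != set0 -> exists B, subfactor A B.
Proof.
case/set0Pn=> a Aa.
pose P (B : {set G}) := diffset A A :&: diffset B B == [set 0].
have D0 : forall (X : {set G}) x, x \in X -> 0 \in diffset X X.
  by move=> X x Xx; apply/imset2P; exists x x; rewrite ?subrr.
have DN : forall (X : {set G}) x, x \in diffset X X -> - x \in diffset X X.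
  move=> X x /imset2P[u v Xu Xv ->]; apply/imset2P; exists v u => //.
  by rewrite opprB.
have P0 : P [set 0].
  apply/eqP/setP=> x; rewrite !inE; apply/andP/eqP=> [[_]|->].
    by case/imset2P=> u v; rewrite !inE => /eqP-> /eqP-> ->; rewrite subrr.
  by split; [apply: D0 Aa | apply: (D0 _ 0); rewrite inE].
case: (arg_maxnP (fun B : {set G} => #|B|) P0) => B PB maxB.
exists B; apply/andP; split; first exact: PB.
rewrite -subTset; apply/subsetP=> x _.
have [Bx|nBx] := boolP (x \in B).
  by apply/imset2P; exists 0 x; rewrite ?add0r //; apply: D0 Aa.
have nP : ~~ P (x |: B).
  by apply/negP=> /maxB /=; rewrite cardsU1 nBx add1n ltnn.
have [d [d0 dA dB]] :
    exists d, [/\ d != 0, d \in diffset A A & d \in diffset (x |: B) (x |: B)].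
  move: nP; rewrite /P eqEsubset negb_and => /orP[|].
    by case/subsetPn=> d; rewrite !inE => /andP[dA dB] d0; exists d.
  rewrite sub1set inE negb_and (D0 _ _ Aa) /=.
  by rewrite (D0 _ x) // !inE eqxx.
case/imset2P: dB => u v; rewrite !inE.
case/orP=> [/eqP->|Bu] /orP[/eqP->|Bv] Ed.
- by rewrite Ed subrr eqxx in d0.
- by apply/imset2P; exists d v; rewrite // Ed subrK.
- apply/imset2P; exists (- d) u; rewrite ?DN //.
  by rewrite Ed opprB subrK.
have : d \in diffset A A :&: diffset B B.
  by rewrite inE dA; apply/imset2P; exists u v.
by rewrite (eqP PB) inE (negPf d0).
Qed.

Lemma lower_subindexP (G : finZmodType) (A : {set G}) : A != set0 ->
  (exists2 B, subfactor A B & #|B| = lower_subindex A) /\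
  (forall B, subfactor A B -> (lower_subindex A <= #|B|)%N).
Proof.
move=> /subfactor_exists[B0 sB0].
have lb B : subfactor A B -> (lower_subindex A <= #|B|)%N.
  by move=> sB; rewrite /lower_subindex (bigminD1 B) //= geq_minl.
split=> //.
case: (arg_minnP (fun B : {set G} => #|B|) sB0) => B sB minB.
exists B => //; apply/eqP; rewrite eqn_leq lb // andbT /lower_subindex.
elim/big_ind: _ => [|p q lep leq|C sC]; first exact: max_card.
  by rewrite leq_min lep.
exact: minB.
Qed.

Lemma upper_subindexP (G : finZmodType) (A : {set G}) : A != set0 ->
  (exists2 B, subfactor A B & #|B| = upper_subindex A) /\
  (forall B, subfactor A B -> (#|B| <= upper_subindex A)%N).
Proof.
move=> /subfactor_exists[B0 sB0].
split=> [|B sB]; last by rewrite /upper_subindex (bigD1 B) //= leq_maxl.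
have c0 : (0 < #|[pred B | subfactor A B]|)%N by apply/card_gt0P; exists B0.
by have [B sB eB] := eq_bigmax_cond (fun B : {set G} => #|B|) c0; exists B.
Qed.

(* Main.v *)
(** For [A = {0, ..., m}] the difference set [A - A] is the arc [{-m, ..., m}].
    If [B] is a subfactor then the translates of [A] by [B] are disjoint, whence
    [(m + 1) |B| <= n], and the translates of [A - A] by [B] cover, whence
    [n <= (2m + 1) |B|].  Conversely, a set whose cyclically consecutive gaps
    all lie in [[m + 1, 2m + 1]] is a subfactor, and when
    [k (m + 1) <= n <= k (2m + 1)] the [k] balanced points [floor (i n / k)]
    form such a set; both extreme values of [k] satisfy these bounds. *)

Require Import Defs.
From mathcomp Require Import all_boot all_order all_algebra zify.
Import Order.TTheory GRing.Theory Num.Theory.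
Local Open Scope ring_scope.

(** * Counting bounds for subfactors *)

Lemma card_subfactor_packing (G : finZmodType) (A B : {set G}) :
  subfactor A B -> (#|A| * #|B| <= #|G|)%N.
Proof.
case/andP=> /eqP AB0 _; rewrite -cardsX.
(* Addition is injective on [A * B]: a collision a + b = a' + b' puts a - a' = b' - b in both
   difference sets, so it is 0. *)
rewrite -(card_in_imset (f := fun p : G * G => p.1 + p.2)) ?max_card //.
move=> [a b] [a' b'] /setXP[/= Aa Bb] /setXP[/= Aa' Bb'] /= eqab.
have eqd : a - a' = b' - b.
  by apply/eqP; rewrite subr_eq addrAC eq_sym subr_eq eqab addrC.
have: a - a' \in diffset A A :&: diffset B B.
  rewrite inE {2}eqd; apply/andP; split; apply/imset2P.
    by exists a a'.
  by exists b' b.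
rewrite AB0 inE subr_eq0 => /eqP eqa.
by move: eqab; rewrite eqa => /addrI ->.
Qed.

Lemma card_subfactor_covering (G : finZmodType) (A B : {set G}) :
  subfactor A B -> (#|G| <= #|diffset A A| * #|B|)%N.
Proof.
case/andP=> _ /eqP AB; rewrite -cardsT -AB -cardsX /sumset curry_imset2X.
exact: leq_imset_card.
Qed.

(** * Balanced points on a circle of length [N] *)

Section BalancedPoints.

Variables (N k d e : nat).
Hypotheses (k_gt0 : (0 < k)%N) (kdN : (k * d <= N)%N) (Nke : (N <= k * e)%N).

Let b i := (i * N %/ k)%N.

(** One step adds the rational [N / k] under the floor; it lies between the integers [d] and [e],
    which pass through the floor. *)
Lemma balanced_gap_ge i : (b i + d <= b i.+1)%N.
Proof.
rewrite /b leq_divRL // mulnDl mulSn addnC (mulnC d).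
by rewrite leq_add ?leq_divM.
Qed.

Lemma balanced_gap_le i : (b i.+1 <= b i + e)%N.
Proof.
rewrite /b addnC -divnMDl // leq_div2r // mulSn leq_add2r.
by rewrite mulnC.
Qed.

Lemma balanced_dist_ge i j : (i < j)%N -> (b i + d <= b j)%N.
Proof.
move=> ltij; apply: (leq_trans (balanced_gap_ge i)).
by rewrite leq_div2r // leq_mul2r ltij orbT.
Qed.

(** Advancing [k] indices is one full turn, so cyclic gaps can be treated as gaps between natural
    numbers. *)
Lemma balanced_wrap i : b (i + k) = (b i + N)%N.
Proof. by rewrite /b mulnDl addnC mulnC divnMDl // addnC. Qed.

Lemma balanced_locate x : (x < N)%N ->
  exists2 i, (i < k)%N & (b i <= x < b i.+1)%N.
Proof.
(* The induction varies only the number of gaps; [b] keeps its own divisor. *)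
have -> : N = b k by rewrite /b mulKn.
elim: k => [|j IHj]; first by rewrite /b mul0n div0n.
case: (ltnP x (b j)) => [/IHj[i ltij bi] _|lebx ltxb].
  by exists i => //; apply: ltnW.
by exists j; rewrite // lebx.
Qed.

End BalancedPoints.

(** * Arcs in the cyclic group *)

Lemma inZpD p a b : inZp (a + b) = inZp a + inZp b :> 'I_p.+1.
Proof. by apply: val_inj; rewrite /= modnDm. Qed.

Lemma inZp0 p : inZp 0 = 0 :> 'I_p.+1.
Proof. exact/val_inj/mod0n. Qed.

Section InitialSegment.

Variables (n : nat) (m : 'I_n.+1).

Let A := initseg m.

Lemma card_initseg : #|A| = m.+1.
Proof.
rewrite -sum1_card (eq_bigl (fun i : 'I_n.+1 => i < m.+1)%N) => [|i].
  by rewrite -(big_ord_widen _ (fun=> 1%N)) ?sum1_card ?card_ord.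
by rewrite inE ltnS.
Qed.

Lemma mem_diffset_initseg a b : (a <= b + m)%N -> (b <= a + m)%N ->
  inZp a - inZp b \in diffset A A.
Proof.
have ltmn := ltn_ord m.
have Az c : (c <= m)%N -> inZp c \in A.
  by move=> lecm; rewrite inE /= modn_small // (leq_ltn_trans lecm).
move=> leab leba; apply/imset2P; case: (leqP b a) => ltab.
  exists (inZp (a - b)) (inZp 0); try by apply: Az; lia.
  rewrite -{1}(subnK ltab) inZpD addrK.
  by rewrite inZp0 subr0.
exists (inZp 0) (inZp (b - a)); try by apply: Az; lia.
rewrite -{1}(subnK (ltnW ltab)) inZpD opprD addrC addrNK.
by rewrite inZp0 sub0r.
Qed.

(** If the difference were [u - v] with [u] and [v] at most [m], then [n.+1] would divide
    [a + v - (u + b)], which lies strictly between 0 and [n.+1]. *)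
Lemma notin_diffset_initseg a b : (b + m < a)%N -> (a + m < b + n.+1)%N ->
  inZp a - inZp b \notin diffset A A.
Proof.
move=> ltba ltab; apply/imset2P=> -[u v]; rewrite !inE => leum levm.
move=> eq_ab; have : inZp (a + v) = inZp (u + b) :> 'I_n.+1.
  rewrite !inZpD !valZpK; apply/eqP.
  by rewrite eq_sym -subr_eq addrAC eq_sym -subr_eq eq_ab.
move/(congr1 val) => /= /eqP; rewrite eqn_mod_dvd; last lia.
by move/dvdn_leq; lia.
Qed.

(** Only an upper bound: the arc may wrap around and overlap itself. *)
Lemma card_diffset_initseg : (#|diffset A A| <= 2 * m + 1)%N.
Proof.
rewrite -[leqRHS]card_ord -cardsT.
pose f (i : 'I_(2 * m + 1)) : 'I_n.+1 := inZp i - m.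
apply: leq_trans (leq_imset_card f _).
apply/subset_leq_card/subsetP=> _ /imset2P[u v + + ->].
rewrite !inE => leum levm.
have ltum : (u + m - v < 2 * m + 1)%N by lia.
have : inZp (u + m - v) + inZp v = inZp u + inZp m :> 'I_n.+1.
  by rewrite -!inZpD subnK //; lia.
rewrite !valZpK => eq_um; apply/imsetP; exists (Ordinal ltum) => //=.
by apply/eqP; rewrite subr_eq addrAC eq_sym subr_eq eq_um.
Qed.

Lemma subfactor_of_card k :
    (0 < k)%N -> (k * (m + 1) <= n.+1)%N -> (n.+1 <= k * (2 * m + 1))%N ->
  exists2 B : {set 'I_n.+1}, subfactor A B & #|B| = k.
Proof.
move=> k_gt0 kmn nkm; pose b i := (i * n.+1 %/ k)%N.
have b_dist i j : (i < j)%N -> (b i + (m + 1) <= b j)%N.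
  exact: balanced_dist_ge.
have b_wrap i : b (i + k)%N = (b i + n.+1)%N by apply: balanced_wrap.
have sep i j : (i < k)%N -> (j < k)%N -> i != j ->
    inZp (b i) - inZp (b j) \notin diffset A A.
  move=> ltik ltjk; rewrite neq_ltn => /orP[ltij|ltji].
    (* A full turn is added to the smaller point, so that the difference has a positive
       representative; its lower bound is the wrapped gap from [j] to [i + k]. *)
    have -> : inZp (b i) = inZp (b i + n.+1) :> 'I_n.+1.
      by apply: val_inj; rewrite /= modnDr.
    apply: notin_diffset_initseg; have := b_dist _ _ ltij; last lia.
    by have := b_dist j (i + k)%N; rewrite b_wrap; lia.
  apply: notin_diffset_initseg; have := b_dist _ _ ltji; first lia.
  by have := b_dist i (j + k)%N; rewrite b_wrap; lia.
have DA0 : 0 \in diffset A A.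
  by rewrite -(subrr (inZp 0)) mem_diffset_initseg ?leq0n.
pose B : {set 'I_n.+1} := [set inZp (b i) | i : 'I_k].
exists B; last first.
  rewrite card_imset ?card_ord // => i j eqb.
  apply/eqP; apply: contraLR DA0 => neqij.
  by rewrite -(subrr (inZp (b i))) {2}eqb sep.
apply/andP; split; apply/eqP/setP=> x; rewrite !inE.
  apply/andP/eqP => [[Dx]|->]; last first.
    split=> //; apply/imset2P; exists (inZp (b 0)) (inZp (b 0)).
    - by apply/imsetP; exists (Ordinal k_gt0).
    - by apply/imsetP; exists (Ordinal k_gt0).
    by rewrite subrr.
  case/imset2P=> _ _ /imsetP[i _ ->] /imsetP[j _ ->] def_x; move: Dx.
  rewrite {}def_x; case: (eqVneq i j) => [-> _|neqij]; first by rewrite subrr.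
  by rewrite (negPf (sep _ _ _ _ _)).
have [i ltik /andP[lebx ltxb]] : exists2 i, (i < k)%N & (b i <= x < b i.+1)%N.
  exact: balanced_locate.
have leb : (b i.+1 <= b i + (2 * m + 1))%N by apply: balanced_gap_le.
have cover j : inZp (b j) \in B ->
    (x <= b j + m)%N -> (b j <= x + m)%N ->
    x \in sumset (diffset A A) B.
  move=> Bj lexb lebx'; apply/imset2P.
  exists (inZp x - inZp (b j)) (inZp (b j)) => //.
    exact: mem_diffset_initseg.
  by rewrite subrK valZpK.
(* The gap around [x] has length at most 2m + 1, so [x] is within [m] of its left end or of its
   right end. *)
case: (leqP x (b i + m)%N) => [lexm|ltmx].
  by apply: (cover i) => //; [apply/imsetP; exists (Ordinal ltik) | lia].
apply: (cover i.+1); try lia.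
(* The last gap ends at [b k], which is the point of index 0 modulo [n.+1]. *)
apply/imsetP; case: (eqVneq i.+1 k) => [-> | neik].
  exists (Ordinal k_gt0) => //=; apply: val_inj.
  by rewrite -[k]add0n b_wrap /= modnDr.
have ltSik : (i.+1 < k)%N by rewrite ltn_neqAle neik.
by exists (Ordinal ltSik).
Qed.

End InitialSegment.

(** * Rounded quotients and the two indices *)

Lemma ceil_nat_div (R : archiRealFieldType) (N d k : nat) :
  (0 < d)%N -> (k.-1 * d < N <= k * d)%N ->
  Num.ceil (N%:R / d%:R : R) = k :> int.
Proof.
case: k => [|k] d_gt0 /andP[ltN leN]; first lia.
have d_gt0' : 0 < d%:R :> R by rewrite ltr0n.
apply: ceil_def; have -> : (k.+1 : int) - 1 = k :> int by lia.
by rewrite ltr_pdivlMr // ler_pdivrMr // -!pmulrn -!natrM ltr_nat ler_nat ltN.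
Qed.

Lemma floor_nat_div (R : archiRealFieldType) (N d : nat) :
  (0 < d)%N -> Num.floor (N%:R / d%:R : R) = (N %/ d)%N :> int.
Proof.
move=> d_gt0; have d_gt0' : 0 < d%:R :> R by rewrite ltr0n.
apply: floor_def.
have -> : ((N %/ d)%N : int) + 1 = (N %/ d).+1 :> int by lia.
rewrite ler_pdivlMr // ltr_pdivrMr // -!pmulrn -!natrM ltr_nat ler_nat.
by rewrite leq_divM ltn_ceil.
Qed.

Theorem theorem2p1 (n : nat) (m : 'I_n.+1) :
  (lower_subindex (initseg m) : int)
    = Num.ceil (n.+1%:R / (2 * m + 1)%N%:R : rat)
  /\ (upper_subindex (initseg m) : int)
    = Num.floor (n.+1%:R / (m + 1)%N%:R : rat).
Proof.
have ltmn := ltn_ord m.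
have A_neq0 : initseg m != set0.
  by apply/set0Pn; exists m; rewrite inE.
have [[B sB cB] lowB] := lower_subindexP A_neq0.
have [[C sC cC] uppC] := upper_subindexP A_neq0.
split; apply/esym.
  apply: ceil_nat_div; first lia.
  have := card_subfactor_covering _ _ _ sB; rewrite card_ord cB => cov.
  have cov' : (n.+1 <= lower_subindex (initseg m) * (2 * m + 1))%N.
    by apply: leq_trans cov _; rewrite mulnC leq_mul2l card_diffset_initseg orbT.
  rewrite cov' andbT.
  (* The group has order [n.+1], so this is the ceiling of its order over 2m + 1. *)
  pose k := (n %/ (2 * m + 1)).+1.
  have lek : (k.-1 * (2 * m + 1) <= n)%N by apply: leq_divM.
  have ltk : (n < k * (2 * m + 1))%N by apply: ltn_ceil; lia.
  have [||//|D sD cD] := @subfactor_of_card n m k.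
  - by [].
  (* For k = 1 this is m <= n; for k >= 2, (k - 1)(2m + 1) + 1 exceeds k(m + 1) by m(k - 2) >= 0. *)
  - case: k lek {ltk} => [|[|j]]; nia.
  have := lowB D sD; rewrite cD => leLk.
  by rewrite ltnS; apply: leq_trans lek; rewrite leq_mul2r; lia.
rewrite floor_nat_div; last lia.
congr Posz; apply/eqP; rewrite eqn_leq; apply/andP; split; last first.
  have := card_subfactor_packing _ _ _ sC.
  by rewrite card_ord cC card_initseg leq_divRL ?addn1 // mulnC.
set k := (_ %/ _)%N.
have lek : (k * (m + 1) <= n.+1)%N by apply: leq_divM.
have ltk : (n.+1 < k.+1 * (m + 1))%N by apply: ltn_ceil; lia.
have k_gt0 : (0 < k)%N by rewrite divn_gt0; lia.
(* Covering holds because n + 1 <= km + k + m <= k(2m + 1), the last step using k >= 1. *)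
have [//|//||D sD <-] := @subfactor_of_card n m k; first nia.
exact: uppC.
Qed.
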